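(* Let $n, D \geq 1$ be integers and let $A, B \in \mathbb{R}^{n \times D}$ be nonzero matrices such that $A A^T = B B^T = M$. Then $$A A^T \circ B B^T \ \geq \ \frac{1}{\operatorname{rk}(M)}\, d_{A B^T}\, d_{A B^T}^T.$$
   Context: For matrices $X=(x_{jk})$, $Y=(y_{jk})$ of the same size, the Schur (entrywise) product $X \circ Y$ has $(j,k)$ entry $x_{jk} y_{jk}$. For symmetric (Hermitian) $n \times n$ matrices, $X \geq Y$ (Loewner ordering) means that $X - Y$ is positive semidefinite. For a square $n \times n$ matrix $N=(n_{jk})$, $d_N := (n_{11}, \dots, n_{nn})^T$ denotes the column vector of its diagonal entries. $\operatorname{rk}$ denotes rank. *)

(* Defs.v *)
From HB Require Import structures.
From mathcomp Require Import all_boot all_order all_algebra.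
From mathcomp Require Import reals.

Set Implicit Arguments.
Unset Strict Implicit.
Unset Printing Implicit Defensive.

Import Order.TTheory GRing.Theory Num.Theory.
Local Open Scope ring_scope.

Definition schurmx (R : realType) (m n : nat) (X Y : 'M[R]_(m, n))
  : 'M[R]_(m, n) := map2_mx *%R X Y.

Definition diag_col (R : realType) (n : nat) (N : 'M[R]_n) : 'cV[R]_n :=
  \col_i N i i.

(* Over the reals the quadratic form does not force symmetry, so it is part
   of the definition. *)
Definition psdmx (R : realType) (n : nat) (X : 'M[R]_n) : Prop :=
  X \is symmetricmx /\ forall x : 'cV[R]_n, 0 <= (x^T *m X *m x) 0 0.

Definition loewner_le (R : realType) (n : nat) (X Y : 'M[R]_n) : Prop :=
  psdmx (Y - X).

(* Main.v *)
Require Import Defs.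
From HB Require Import structures.
From mathcomp Require Import all_boot all_order all_algebra.
From mathcomp Require Import reals.
From mathcomp Require Import ring.

(** Write [X] for the diagonal matrix of a test vector [x] and [C = A^T X B].
    Then [x^T (M o M) x = tr (X M X M)] is the squared Frobenius norm of [C],
    while [x^T d = tr C].  If [P] is the orthogonal projector onto the row space
    of [A], then [P C = C] and [tr P = rk A = rk M], so Cauchy-Schwarz for the
    Frobenius inner product of [C] and [P] gives [(tr C)^2 <= rk M * |C|^2]. *)

Set Implicit Arguments.
Unset Strict Implicit.
Unset Printing Implicit Defensive.

Import Order.TTheory GRing.Theory Num.Theory.
Local Open Scope ring_scope.

Section Gram.
Variable F : realFieldType.

Lemma mxtrace_mul_tr m n (C : 'M[F]_(m, n)) :
  \tr (C *m C^T) = \sum_i \sum_j C i j ^+ 2.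
Proof.
apply: eq_bigr => i _; rewrite mxE.
by apply: eq_bigr => j _; rewrite mxE -expr2.
Qed.

Lemma mxtrace_mul_tr_ge0 m n (C : 'M[F]_(m, n)) : 0 <= \tr (C *m C^T).
Proof.
by rewrite mxtrace_mul_tr; do 2![apply: sumr_ge0 => ? _]; apply: sqr_ge0.
Qed.

Lemma mulmx_tr_eq0 m n (C : 'M[F]_(m, n)) : C *m C^T = 0 -> C = 0.
Proof.
move=> C0; have := mxtrace_mul_tr C; rewrite C0 mxtrace0 => /esym/eqP.
rewrite psumr_eq0 => [/allP C1|i _]; last by apply: sumr_ge0 => j _; apply: sqr_ge0.
apply/matrixP => i j; rewrite mxE; apply/eqP.
have := C1 i (mem_index_enum i); rewrite /= psumr_eq0 => [/allP C2|k _].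
  by have := C2 j (mem_index_enum j); rewrite /= sqrf_eq0.
exact: sqr_ge0.
Qed.

(** Both matrices have the same left kernel: if [v *m A *m A^T = 0], then [v *m A] has a vanishing
    sum of squares, hence is 0 over an ordered field. *)
Lemma mxrank_mul_tr m n (A : 'M[F]_(m, n)) : \rank (A *m A^T) = \rank A.
Proof.
apply/eqP; rewrite eqn_leq mxrankM_maxl /=.
have sub : (kermx (A *m A^T) <= kermx A)%MS.
  apply/sub_kermxP/mulmx_tr_eq0.
  by rewrite trmx_mul mulmxA -(mulmxA _ A) mulmx_ker mul0mx.
have := mxrankS sub; rewrite !mxrank_ker => le.
by rewrite leq_sub2lE ?rank_leq_row // in le.
Qed.

(** For a basis [W] of the row space, the Gram matrix [G = W *m W^T] is invertible and
    [P = W^T *m invmx G *m W]. Cyclicity turns [\tr P] into the trace of an identity matrix of size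
    [\rank A]. *)
Lemma row_space_projector m n (A : 'M[F]_(m, n)) :
  exists P : 'M[F]_n,
    [/\ P^T = P, P *m P = P, A *m P = A & \tr P = (\rank A)%:R].
Proof.
set W := row_base A; pose G := W *m W^T.
have Gu : G \in unitmx.
  by rewrite -row_free_unit /row_free mxrank_mul_tr; apply: row_base_free.
have WP : W *m (W^T *m invmx G *m W) = W by rewrite !mulmxA mulmxV // mul1mx.
exists (W^T *m invmx G *m W); split.
- by rewrite !trmx_mul trmx_inv trmx_mul !trmxK mulmxA.
- by rewrite -[LHS]mulmxA WP.
- have /submxP [K AK] : (A <= W)%MS by rewrite eq_row_base.
  by apply: etrans (congr1 (mulmx^~ _) AK) _; rewrite -mulmxA WP.
- by rewrite -mulmxA mxtrace_mulC -mulmxA mulVmx // mxtrace1.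
Qed.

(** Cauchy-Schwarz, proved by expanding the squared norm of [C - t *: P], where [t *: P] is the
    orthogonal projection of [C] onto the line spanned by [P]. *)
Lemma sqr_mxtrace_le n (P C : 'M[F]_n) (r : nat) :
  P^T = P -> P *m P = P -> P *m C = C -> \tr P = r%:R ->
  r%:R^-1 * \tr C ^+ 2 <= \tr (C *m C^T).
Proof.
move=> PT PP PC trP; set t := r%:R^-1 * \tr C.
have CP : \tr (C *m P) = \tr C by rewrite mxtrace_mulC PC.
have PCT : \tr (P *m C^T) = \tr C by rewrite -[in LHS]PT -trmx_mul mxtrace_tr.
have sq : \tr ((C - t *: P) *m (C - t *: P)^T) =
    \tr (C *m C^T) - r%:R^-1 * \tr C ^+ 2.
  have -> : (C - t *: P)^T = C^T - t *: P.
    by rewrite -[in RHS]PT; apply/matrixP => i j; rewrite !mxE.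
  rewrite mulmxBl !mulmxBr -!scalemxAl -!scalemxAr PP.
  rewrite !linearB !linearZ /= CP PCT trP /t.
  (* If [r] is 0, the convention that 0 has inverse 0 makes [t] vanish, and both sides reduce to
     [\tr (C *m C^T)]. *)
  have [->|r0] := eqVneq (r%:R : F) 0; last by field.
  by rewrite invr0; ring.
by rewrite -subr_ge0 -sq mxtrace_mul_tr_ge0.
Qed.

End Gram.

(** Both sides expand to the double sum of [x i 0 * x j 0 * M i j * N i j]. *)
Lemma quad_schurmx (R : realType) n (M N : 'M[R]_n) (x : 'cV[R]_n) :
  (x^T *m schurmx M N *m x) 0 0 =
  \tr (diag_mx x^T *m M *m diag_mx x^T *m N^T).
Proof.
rewrite mul_diag_mx mul_mx_diag [LHS]mxE.
transitivity (\sum_j \sum_i x i 0 * x j 0 * (M i j * N i j)).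
  apply: eq_bigr => j _; rewrite mxE big_distrl.
  by apply: eq_bigr => i _; rewrite !mxE /=; ring.
rewrite exchange_big; apply: eq_bigr => i _.
by rewrite mxE; apply: eq_bigr => j _; rewrite !mxE; ring.
Qed.

Lemma mul_tr_diag_col (R : realType) n (N : 'M[R]_n) (x : 'cV[R]_n) :
  (x^T *m diag_col N) 0 0 = \tr (diag_mx x^T *m N).
Proof. by rewrite mul_diag_mx mxE; apply: eq_bigr => i _; rewrite !mxE. Qed.

Theorem corollary1p8 (R : realType) (n D : nat) (hn : (1 <= n)%N)
    (hD : (1 <= D)%N) (A B : 'M[R]_(n, D)) (M : 'M[R]_n)
    (hA : A != 0) (hB : B != 0)
    (hAM : A *m A^T = M) (hBM : B *m B^T = M) :
  loewner_le
    ((\rank M)%:R^-1 *: (diag_col (A *m B^T) *m (diag_col (A *m B^T))^T))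
    (schurmx (A *m A^T) (B *m B^T)).
Proof.
have MT : M^T = M by rewrite -hAM trmx_mul trmxK.
split.
  rewrite is_hermitianmxE expr0 scale1r map_mx_id // hAM hBM.
  apply/eqP/matrixP => i j; have Mji : M j i = M i j by rewrite -[in LHS]MT mxE.
  by rewrite !mxE !big_ord1 !mxE Mji; ring.
move=> x; set d := diag_col _; set X := diag_mx x^T.
have [P [PT PP AP trP]] := row_space_projector A.
pose C := A^T *m X *m B.
have PC : P *m C = C by rewrite /C !mulmxA -{1}PT -trmx_mul AP.
have trC : \tr C = (x^T *m d) 0 0.
  (* Transposing first makes [A *m B^T] appear; cyclicity alone would give [B *m A^T]. *)
  rewrite mul_tr_diag_col -mxtrace_tr /C !trmx_mul trmxK tr_diag_mx.
  by rewrite mxtrace_mulC -mulmxA mxtrace_mulC.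
have normC : \tr (C *m C^T) = (x^T *m schurmx M M *m x) 0 0.
  (* The inner [B *m B^T] supplies one factor [M]; cyclicity then joins [A] and [A^T] into the
     other. *)
  have -> : C *m C^T = A^T *m (X *m M *m X *m A).
    by rewrite /C !trmx_mul trmxK tr_diag_mx -hBM !mulmxA.
  by rewrite mxtrace_mulC -(mulmxA _ A) hAM quad_schurmx MT.
have quad_dd : (x^T *m (d *m d^T) *m x) 0 0 = \tr C ^+ 2.
  have -> : x^T *m (d *m d^T) *m x = (x^T *m d) *m (x^T *m d)^T.
    by rewrite trmx_mul trmxK !mulmxA.
  by rewrite mxE big_ord1 [_^T _ _]mxE -trC expr2.
have rkM : \rank M = \rank A by rewrite -hAM mxrank_mul_tr.
rewrite hAM hBM mulmxBr mulmxBl -scalemxAr -scalemxAl.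
rewrite [X in 0 <= X]mxE [X in _ + X]mxE [X in _ - X]mxE quad_dd -normC.
by rewrite subr_ge0 rkM; apply: sqr_mxtrace_le PC trP.
Qed.
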